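(* Let $n>1$. For every infinite non-tame discrete subset $D\subset\mathbb{C}^n$ there is a tame discrete subset $D'\subset\mathbb{C}^n$ and a bijection $\alpha:D\to D'$ such that $$\|\alpha(v)-v\| \le \frac{1}{\sqrt{2}}\|v\| \quad \text{for all } v\in D$$ and $$\|w-\alpha^{-1}(w)\| \le \|w\| \quad \text{for all } w\in D'.$$
   Context: $\|\cdot\|$ denotes the standard Hermitian (Euclidean) norm on $\mathbb{C}^n$. A subset of $\mathbb{C}^n$ is called discrete if it has no accumulation point in $\mathbb{C}^n$ (equivalently, every ball of finite radius contains only finitely many of its points). A discrete subset $D\subset\mathbb{C}^n$ ($n\ge 2$) is called tame if there exists a holomorphic automorphism (biholomorphic self-map) $\phi$ of $\mathbb{C}^n$ such that $\phi(D)=\mathbb{Z}\times\{0\}^{n-1}\subset\mathbb{C}\times\mathbb{C}^{n-1}=\mathbb{C}^n$; otherwise it is called non-tame. *)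

(* Defs.v *)
From mathcomp Require Import all_boot all_order all_algebra.
From mathcomp Require Import all_classical all_reals all_analysis.
From mathcomp.real_closed Require Import complex.

Set Implicit Arguments.
Unset Strict Implicit.
Unset Printing Implicit Defensive.

Import Order.TTheory GRing.Theory Num.Theory.
Import numFieldNormedType.Exports.

Local Open Scope classical_set_scope.
Local Open Scope ring_scope.

(* [R[i]] seen through its [numFieldType] structure, from which the library
   derives the topology and the norm of a field; [R[i]] itself has none. *)
Definition Cplx (R : realType) : numFieldType := R[i].

(* The norm the library puts on row vectors is the sup norm; here that norm only
   serves to define the topology and the differential, for which it is
   equivalent to the Hermitian one.  All metric estimates use this [hnorm]. *)
Definition hnorm (R : realType) (n : nat) (v : 'rV[Cplx R]_n) : R :=
  Num.sqrt (\sum_(i < n) Normc.normc (v ord0 i) ^+ 2).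

(* No accumulation point in the whole space, so in particular [D] is closed;
   this is stronger than the subspace topology of [D] being discrete. *)
Definition discrete_subset (R : realType) (n : nat) (D : set 'rV[Cplx R]_n) :
    Prop :=
  limit_point D = set0.

(* The scalars are [Cplx R], so the differential is complex linear. *)
Definition holomorphic (R : realType) (n : nat)
    (f : 'rV[Cplx R]_n -> 'rV[Cplx R]_n) : Prop :=
  forall x, differentiable f x.

Definition holomorphic_automorphism (R : realType) (n : nat)
    (f : 'rV[Cplx R]_n -> 'rV[Cplx R]_n) : Prop :=
  holomorphic f /\
  exists g, [/\ holomorphic g, cancel f g & cancel g f].

Definition integer_axis (R : realType) (n : nat) : set 'rV[Cplx R]_n :=
  [set \row_(i < n) (if val i == 0%N then k%:~R else 0) | k in [set: int]].
Arguments integer_axis : clear implicits.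

Definition tame (R : realType) (n : nat) (D : set 'rV[Cplx R]_n) : Prop :=
  exists f, holomorphic_automorphism f /\ f @` D = integer_axis R n.

(* Main.v *)
From HB Require Import structures.
Require Import Defs.
From mathcomp Require Import all_boot all_order all_algebra.
From mathcomp Require Import all_classical all_reals all_analysis.
From mathcomp.real_closed Require Import complex.
From mathcomp Require Import ring lra.

Import Order.TTheory GRing.Theory Num.Theory.
Import numFieldNormedType.Exports.

Local Open Scope classical_set_scope.
Local Open Scope ring_scope.

Set Implicit Arguments.
Unset Strict Implicit.
Unset Printing Implicit Defensive.

(** Only the first coordinate has to be changed, and tameness of the new set is
    then visible from that coordinate alone.

    Two facts are combined.  If the first coordinate is injective on a sequence
    in C^n, n >= 2, and its modulus tends to infinity along the sequence, then
    the range of the sequence is tame ([tame_of_injective_coord]): interpolation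
    by entire functions ([entire_interpolation]) yields three shears which carry
    the points to the integers of the first axis.  And every discrete set can be
    brought into this position by a controlled displacement: a point v with
    first coordinate c is moved to first coordinate c + t or c - t, with t real,
    |v|/4 <= t <= |v|/2, the sign being that of Re c.  Then the new first
    coordinate has modulus at least t.  So it tends to infinity with |v|, and
    the displacement t is at most |v|/2 <= |v|/sqrt 2 and at most the norm of
    the image point.  The origin stays in place; for v <> 0 infinitely many
    values of t are available, hence one can choose them one after the other so
    that the new first coordinates are pairwise distinct
    ([injective_selection], [admissible_avoid]).

    The entire functions are sums of polynomials p_k for which the sums of the
    coefficientwise majorants converge at every radius.  For |h| <= 1 the
    second-order Taylor remainder of a polynomial at z is bounded by |h|^2 times
    its majorant at |z| + 1 ([horner_taylor]); this bound survives the passage to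
    the limit and gives complex differentiability. *)

(** * The modulus of a complex number *)

Definition cabs (R : realType) (z : Cplx R) : R := Normc.normc z.

(** The codomain [Cplx R] selects the topology and norm of a field. *)
Definition cplx_of_real (R : realType) (x : R) : Cplx R := (x%:C)%C.

Section ComplexModulus.
Variable R : realType.
Implicit Types (z w : Cplx R) (x : R).

Lemma cabs_ge0 z : 0 <= cabs z.
Proof. by case: z => a b; exact: sqrtr_ge0. Qed.

Lemma normCplxE z : `|z| = cplx_of_real (cabs z).
Proof. by []. Qed.

Lemma le_cplx_of_real x y : (cplx_of_real x <= cplx_of_real y) = (x <= y).
Proof. exact: lecR. Qed.

Lemma cplx_gt0P z : 0 < z -> exists2 x, 0 < x & z = cplx_of_real x.
Proof.
by case: z => a b; rewrite ltcE /= => /andP[/eqP-> a0]; exists a.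
Qed.

Lemma cabs0 : cabs (0 : Cplx R) = 0.
Proof. exact: Normc.normc0. Qed.

Lemma cabs1 : cabs (1 : Cplx R) = 1.
Proof. exact: Normc.normc1. Qed.

Lemma cabsM z w : cabs (z * w) = cabs z * cabs w.
Proof. exact: Normc.normcM. Qed.

Lemma cabsV z : cabs z^-1 = (cabs z)^-1.
Proof. exact: Normc.normcV. Qed.

Lemma cabsX z m : cabs (z ^+ m) = cabs z ^+ m.
Proof. by elim: m => [|m IH]; rewrite ?expr0 ?cabs1 // !exprS cabsM IH. Qed.

Lemma cabsD z w : cabs (z + w) <= cabs z + cabs w.
Proof. exact: le_normcD. Qed.

Lemma cabsN z : cabs (- z) = cabs z.
Proof. exact: normcN. Qed.

Lemma cabs_eq0 z : (cabs z == 0) = (z == 0).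
Proof.
by apply/eqP/eqP => [/Normc.eq0_normc //|->]; exact: cabs0.
Qed.

Lemma cabs_sum (I : Type) (r : seq I) (P : pred I) (F : I -> Cplx R) :
  cabs (\sum_(i <- r | P i) F i) <= \sum_(i <- r | P i) cabs (F i).
Proof.
elim/big_rec2: _ => [|i y x _ le_xy]; first by rewrite cabs0.
by rewrite (le_trans (cabsD _ _)) // lerD2l.
Qed.

Lemma cabs_real x : cabs (cplx_of_real x) = `|x|.
Proof. by rewrite /cabs /= expr0n /= addr0 sqrtr_sqr. Qed.

Lemma cabs_nat m : cabs (m%:R : Cplx R) = m%:R.
Proof.
rewrite -(rmorph_nat (real_complex R) m) -[LHS]/(cabs (cplx_of_real _)).
by rewrite cabs_real normr_nat.
Qed.

Lemma norm_Re_le z : `|complex.Re z| <= cabs z.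
Proof.
by case: z => a b; rewrite /cabs /= -sqrtr_sqr ler_wsqrtr // lerDl sqr_ge0.
Qed.

Lemma norm_Im_le z : `|complex.Im z| <= cabs z.
Proof.
by case: z => a b; rewrite /cabs /= -sqrtr_sqr ler_wsqrtr // lerDr sqr_ge0.
Qed.

Lemma cplx_of_real_continuous : continuous (@cplx_of_real R).
Proof.
move=> x; apply/(@cvgrPdist_le (Cplx R) (Cplx R)) => e /cplx_gt0P[d d0 ->].
apply/nbhs_ballP; exists d => // y /ltW le_d.
by rewrite normCplxE le_cplx_of_real /cplx_of_real -rmorphB cabs_real.
Qed.

Lemma cabs_continuous : continuous (@cabs R).
Proof.
move=> z; apply/(@cvgrPdist_le R R (Cplx R) (nbhs z) (nbhs_filter z)) => e e0.
have e0' : 0 < cplx_of_real e by rewrite ltcR.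
apply/nbhs_ballP; exists (cplx_of_real e) => // w => /ltW.
rewrite normCplxE le_cplx_of_real => zw.
rewrite ler_norml; apply/andP; split.
  have := cabsD z (w - z); rewrite addrC subrK -(opprB z w) cabsN; lra.
by have := cabsD w (z - w); rewrite addrC subrK; lra.
Qed.

Lemma cvg_Re_Im (s : nat -> Cplx R) (a b : R) :
  (fun n => complex.Re (s n)) @ \oo --> a ->
  (fun n => complex.Im (s n)) @ \oo --> b ->
  exists l : Cplx R, s @ \oo --> l.
Proof.
move=> sa sb; exists (cplx_of_real a + 'i%C * cplx_of_real b).
have -> : s = (fun n => cplx_of_real (complex.Re (s n))
                 + ('i%C : Cplx R) * cplx_of_real (complex.Im (s n))).
  by apply/funext => n; exact: complexE.
have ca : cplx_of_real (complex.Re (s n)) @[n --> \oo] --> cplx_of_real a.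
  by apply: continuous_cvg sa; exact: cplx_of_real_continuous.
have cb : cplx_of_real (complex.Im (s n)) @[n --> \oo] --> cplx_of_real b.
  by apply: continuous_cvg sb; exact: cplx_of_real_continuous.
apply: (cvgD ca); apply: (cvgM _ cb); exact: cvg_cst.
Qed.

End ComplexModulus.

(** * Majorants of polynomials and Taylor estimates *)

Definition entire (R : realType) (f : Cplx R -> Cplx R) : Prop :=
  forall z, differentiable f z.

Definition majorant (R : realType) (p : {poly Cplx R}) (r : R) : R :=
  \sum_(i < size p) cabs p`_i * r ^+ i.

Section Majorant.
Variable R : realType.
Implicit Types (z h : Cplx R) (r : R) (p q : {poly Cplx R}).

(** Complex differentiability is read off a second-order remainder estimate, a
    kind of bound that is stable under limits. *)
Lemma differentiable_quadratic (f : Cplx R -> Cplx R) z (df : Cplx R) (M : R) :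
  (forall h, cabs h <= 1 ->
     cabs (f (z + h) - f z - h * df) <= cabs h ^+ 2 * M) ->
  differentiable f z.
Proof.
move=> fM; apply/derivable1_diffP.
have M0 : 0 <= M.
  by have := fM 1; rewrite cabs1 expr1n (mul1r M) => /(_ (lexx _));
    exact: (le_trans (cabs_ge0 _)).
apply/cvg_ex; exists df; apply/cvgrPdist_le => e /cplx_gt0P[d d0 ->].
(* With this radius the remainder divided by |h| is at most |h| M < d. *)
have m0 : 0 < Num.min 1 (d / (M + 1)).
  by rewrite lt_min ltr01 divr_gt0 // ltr_wpDl.
have m0' : 0 < cplx_of_real (Num.min 1 (d / (M + 1))) by rewrite ltcR.
apply/nbhs_ballP; exists (cplx_of_real (Num.min 1 (d / (M + 1)))) => // h.
rewrite /ball /= sub0r normrN normCplxE ltcR lt_min => /andP[h1 hd] hn0.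
have h0 : 0 < cabs h by rewrite lt_def cabs_ge0 andbT cabs_eq0.
rewrite normCplxE le_cplx_of_real /GRing.scale /= mulr1 addrC -cabsN.
rewrite -(ler_pM2l h0) -cabsM.
have -> : h * - (- (h^-1 * (f (h + z) - f z)) + df)
    = f (z + h) - f z - h * df by rewrite (addrC z); field.
rewrite (le_trans (fM _ (ltW h1))) // expr2 -mulrA ler_pM2l //.
move: hd; rewrite ltr_pdivlMr ?ltr_wpDl // mulrDr mulr1 => hd.
by apply: ltW; apply: le_lt_trans hd; rewrite lerDl cabs_ge0.
Qed.

(** Padding by zero coefficients lets majorants be computed without knowing the
    exact degree. *)
Lemma majorant_wide p n r : (size p <= n)%N ->
  majorant p r = \sum_(i < n) cabs p`_i * r ^+ i.
Proof.
move=> pn; rewrite /majorant (big_ord_widen n (fun i => cabs p`_i * r ^+ i)) //.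
rewrite big_mkcond; apply: eq_bigr => i _; case: ltnP => // ip.
by rewrite nth_default // cabs0 mul0r.
Qed.

Lemma majorant_ge0 p r : 0 <= r -> 0 <= majorant p r.
Proof.
move=> r0; apply: sumr_ge0 => i _.
by rewrite mulr_ge0 ?cabs_ge0 ?exprn_ge0.
Qed.

Lemma majorant_le p r s : 0 <= r -> r <= s -> majorant p r <= majorant p s.
Proof.
move=> r0 rs; apply: ler_sum => i _; rewrite ler_wpM2l ?cabs_ge0 //.
by rewrite lerXn2r // nnegrE // (le_trans r0).
Qed.

Lemma majorant_mulXn p m r : majorant (p * 'X^m) r = majorant p r * r ^+ m.
Proof.
rewrite (@majorant_wide _ (m + size p)); last first.
  have [->|p0] := eqVneq p 0; first by rewrite mul0r size_poly0.
  by rewrite size_mulXn.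
rewrite big_split_ord /= big1 ?add0r; last first.
  by move=> i _; rewrite coefMXn ltn_ord cabs0 mul0r.
rewrite mulr_suml; apply: eq_bigr => i _.
by rewrite coefMXn ltnNge leq_addr /= addKn exprD; ring.
Qed.

Lemma majorantZ (c : Cplx R) p r : majorant (c *: p) r = cabs c * majorant p r.
Proof.
rewrite (@majorant_wide _ (size p)) ?size_scale_leq // mulr_sumr.
by apply: eq_bigr => i _; rewrite coefZ cabsM mulrA.
Qed.

Lemma cabs_horner p z : cabs p.[z] <= majorant p (cabs z).
Proof.
rewrite horner_coef (le_trans (cabs_sum _ _ _)) //.
by apply: ler_sum => i _; rewrite cabsM cabsX.
Qed.

(** By the binomial theorem the remainder is h^2 times a polynomial in z and h
    with nonnegative coefficients; the right-hand factor is the value of that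
    polynomial at |z| and 1, an upper bound since |h| <= 1. *)
Lemma monomial_taylor z h i : cabs h <= 1 ->
  cabs ((z + h) ^+ i - z ^+ i - h * (z ^+ i.-1 *+ i)) <=
  cabs h ^+ 2 * ((cabs z + 1) ^+ i - cabs z ^+ i - cabs z ^+ i.-1 *+ i).
Proof.
move=> h1; elim: i => [|i IH].
  by rewrite !expr0 !mulr0n mulr0 !subrr cabs0 mulr0.
(* Recurrence for the remainder, valid in any commutative ring; it is used for
   z, h and for |z|, 1. *)
have step (S : comRingType) (x y : S) :
  (x + y) ^+ i.+1 - x ^+ i.+1 - y * (x ^+ i *+ i.+1) =
  (x + y) * ((x + y) ^+ i - x ^+ i - y * (x ^+ i.-1 *+ i))
    + y ^+ 2 * (x ^+ i.-1 *+ i).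
  have xi : x ^+ i *+ i.+1 = x * (x ^+ i.-1 *+ i) + x ^+ i.
    by rewrite mulrSr mulrnAr; case: (i) => // j; rewrite -exprS.
  by rewrite xi !exprS; ring.
have := step R (cabs z) 1; rewrite !mul1r expr1n mul1r => ->.
rewrite /= step (le_trans (cabsD _ _)) // [leRHS]mulrDr lerD //.
  rewrite cabsM mulrCA ler_pM ?cabs_ge0 // (le_trans (cabsD _ _)) //.
  by rewrite lerD2l.
by rewrite cabsM cabsX -mulr_natr cabsM cabsX cabs_nat mulr_natr.
Qed.

Lemma monomial_remainder_ge0 r i : 0 <= r ->
  0 <= (r + 1) ^+ i - r ^+ i - r ^+ i.-1 *+ i.
Proof.
move=> r0; have := @monomial_taylor (cplx_of_real r) 1 i.
rewrite cabs1 cabs_real ger0_norm // expr1n (mul1r (_ - _ - _)) => /(_ (lexx _)).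
exact: (le_trans (cabs_ge0 _)).
Qed.

Lemma horner_deriv p z : p^`().[z] = \sum_(i < size p) p`_i * (z ^+ i.-1 *+ i).
Proof.
rewrite -{1}[p]coefK poly_def linear_sum /= horner_sum.
apply: eq_bigr => i _; rewrite derivZ derivXn hornerZ hornerMn hornerXn //.
Qed.

Lemma cabs_horner_deriv p z : cabs p^`().[z] <= majorant p (cabs z + 1).
Proof.
rewrite horner_deriv (le_trans (cabs_sum _ _ _)) //.
apply: ler_sum => i _; rewrite cabsM ler_wpM2l ?cabs_ge0 //.
rewrite -mulr_natr cabsM cabsX cabs_nat mulr_natr.
have := monomial_remainder_ge0 i (cabs_ge0 z).
have : 0 <= cabs z ^+ i by rewrite exprn_ge0 ?cabs_ge0.
lra.
Qed.

Lemma horner_taylor p z h : cabs h <= 1 ->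
  cabs (p.[z + h] - p.[z] - h * p^`().[z]) <=
  cabs h ^+ 2 * majorant p (cabs z + 1).
Proof.
move=> h1; rewrite horner_deriv !horner_coef mulr_sumr -!sumrB.
rewrite (le_trans (cabs_sum _ _ _)) // mulr_sumr.
apply: ler_sum => i _.
have -> : p`_i * (z + h) ^+ i - p`_i * z ^+ i - h * (p`_i * (z ^+ i.-1 *+ i)) =
   p`_i * ((z + h) ^+ i - z ^+ i - h * (z ^+ i.-1 *+ i)) by ring.
rewrite cabsM mulrCA ler_wpM2l ?cabs_ge0 //.
rewrite (le_trans (monomial_taylor _ _ h1)) // ler_wpM2l ?sqr_ge0 //.
have : 0 <= cabs z ^+ i by rewrite exprn_ge0 ?cabs_ge0.
have : 0 <= cabs z ^+ i.-1 *+ i by rewrite mulrn_wge0 // exprn_ge0 ?cabs_ge0.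
lra.
Qed.

End Majorant.

(** * Entire functions with prescribed values *)

Definition diverges (R : realType) (u : nat -> R) : Prop :=
  forall r, exists K, forall k, (K <= k)%N -> r < u k.

Section EntireSeries.
Variable R : realType.
Implicit Types (z : Cplx R) (s u : nat -> Cplx R).

Lemma cabs_lim_le s (l : Cplx R) (M : R) :
  s @ \oo --> l -> (forall n, cabs (s n) <= M) -> cabs l <= M.
Proof.
move=> sl sM.
have cl : cabs (s n) @[n --> \oo] --> cabs l.
  by apply: continuous_cvg sl; exact: cabs_continuous.
apply: (ler_cvg_to cl (cvg_cst M)); exact: nearW.
Qed.

Lemma cvg_real_series (v : nat -> R) (M : R) :
  (forall N, \sum_(k < N) `|v k| <= M) ->
  exists l : R, (fun N => \sum_(k < N) v k) @ \oo --> l.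
Proof.
move=> vM; apply/cvg_ex.
have -> : (fun N => \sum_(k < N) v k) = series v.
  by apply/funext => N; rewrite /series /= big_mkord.
apply: normed_cvg; apply: nondecreasing_is_cvgn.
  apply/nondecreasing_seqP => N.
  by rewrite /normed_series_of /series /= big_nat_recr //= lerDl.
by exists M => _ [N _ <-]; rewrite /normed_series_of /series /= big_mkord.
Qed.

Lemma cvg_complex_series u (M : R) :
  (forall N, \sum_(k < N) cabs (u k) <= M) ->
  exists l : Cplx R, (fun N => \sum_(k < N) u k) @ \oo --> l.
Proof.
move=> uM.
have [a ca] : exists a : R, (fun N => \sum_(k < N) complex.Re (u k)) @ \oo --> a.
  apply: (@cvg_real_series (fun k => complex.Re (u k)) M) => N.
  apply: le_trans (uM N).
  by apply: ler_sum => k _; exact: norm_Re_le.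
have [b cb] : exists b : R, (fun N => \sum_(k < N) complex.Im (u k)) @ \oo --> b.
  apply: (@cvg_real_series (fun k => complex.Im (u k)) M) => N.
  apply: le_trans (uM N).
  by apply: ler_sum => k _; exact: norm_Im_le.
apply: (@cvg_Re_Im _ _ a b).
  by under eq_fun do rewrite (raddf_sum (@complex.Re R)).
by under eq_fun do rewrite (raddf_sum (@complex.Im R)).
Qed.

(** The function and its candidate derivative are termwise sums; the majorant at
    |z| + 1 controls the derivatives and the quadratic remainders of all the
    terms at once. *)
Lemma entire_series (p : nat -> {poly Cplx R}) :
  (forall r, 0 <= r -> exists M, forall N, \sum_(k < N) majorant (p k) r <= M) ->
  exists2 f : Cplx R -> Cplx R, entire f
    & forall z, (fun N => \sum_(k < N) (p k).[z]) @ \oo --> f z.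
Proof.
move=> pM.
have fex : forall z, exists l : Cplx R,
    (fun N => \sum_(k < N) (p k).[z]) @ \oo --> l.
  move=> z; have [M MP] := pM _ (cabs_ge0 z).
  apply: (@cvg_complex_series (fun k => (p k).[z]) M) => N.
  apply: le_trans (MP N).
  by apply: ler_sum => k _; exact: cabs_horner.
have [f fP] := choice fex.
have z1 z : 0 <= cabs z + 1 by rewrite addr_ge0 ?cabs_ge0.
have gex : forall z, exists l : Cplx R,
    (fun N => \sum_(k < N) (p k)^`().[z]) @ \oo --> l.
  move=> z; have [M MP] := pM _ (z1 z).
  apply: (@cvg_complex_series (fun k => (p k)^`().[z]) M) => N.
  apply: le_trans (MP N).
  by apply: ler_sum => k _; exact: cabs_horner_deriv.
have [g gP] := choice gex.
exists f; last exact: fP.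
move=> z; have [M MP] := pM _ (z1 z).
apply: (@differentiable_quadratic _ _ _ (g z) M) => h h1.
have cR : (fun N => \sum_(k < N) (p k).[z + h] - \sum_(k < N) (p k).[z]
            - h * \sum_(k < N) (p k)^`().[z]) @ \oo
          --> f (z + h) - f z - h * g z.
  by apply: cvgB; [apply: cvgB => //|apply: cvgM => //; exact: cvg_cst].
apply: (cabs_lim_le cR) => N; rewrite mulr_sumr -!sumrB.
rewrite (le_trans (cabs_sum _ _ _)) //.
apply: le_trans (_ : \sum_(k < N) cabs h ^+ 2 * majorant (p k) (cabs z + 1) <= _).
  by apply: ler_sum => k _; exact: horner_taylor.
by rewrite -mulr_sumr ler_wpM2l ?sqr_ge0.
Qed.

(** Multiplying by (z / a)^m leaves the value at [a] and the zeros alone, and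
    divides the majorant by at least 2^m on the disc of radius |a| / 2.  For
    [a = 0] this disc is empty, and [q] itself will do. *)
Lemma damped_poly (q : {poly Cplx R}) (a : Cplx R) (e : R) : 0 < e ->
  exists p : {poly Cplx R}, [/\ p.[a] = q.[a],
    forall z, q.[z] = 0 -> p.[z] = 0
  & forall r, 0 <= r -> r < cabs a / 2 -> majorant p r <= e].
Proof.
move=> e0; have [->|a0] := eqVneq a 0.
  exists q; split=> // r r0; rewrite cabs0 mul0r => /(le_lt_trans r0).
  by rewrite ltxx.
pose B := majorant q (cabs a / 2); pose m := Num.bound (B / e).
have B0 : 0 <= B by rewrite majorant_ge0 // divr_ge0 ?cabs_ge0.
have ca0 : cabs a != 0 by rewrite cabs_eq0.
exists (a ^- m *: (q * 'X^m)); split.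
- rewrite hornerZ hornerM hornerXn mulrCA mulVf ?mulr1 // expf_neq0 //.
- by move=> z qz; rewrite hornerZ hornerM qz mul0r mulr0.
- move=> r r0 /ltW ra; rewrite (le_trans (majorant_le _ r0 ra)) //.
  rewrite majorantZ majorant_mulXn -/B cabsV cabsX exprMn exprVn.
  rewrite mulrCA mulKf ?expf_neq0 //.
  rewrite ler_pdivrMr ?exprn_gt0 // -ler_pdivrMl // mulrC.
  have Bm : B / e < m%:R by rewrite archi_boundP // divr_ge0 // ltW.
  by rewrite (le_trans (ltW Bm)) // -natrX ler_nat ltnW // ltn_expl.
Qed.

Lemma sum_pow_half_le N : \sum_(k < N) (2^-1 : R) ^+ k <= 2.
Proof.
suff -> : \sum_(k < N) (2^-1 : R) ^+ k = 2 - 2 * 2^-1 ^+ N.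
  by rewrite gerBl mulr_ge0 // exprn_ge0 // invr_ge0.
elim: N => [|N IH]; first by rewrite big_ord0 expr0 mulr1 subrr.
by rewrite big_ord_recr /= IH exprS; field.
Qed.

(** Newton interpolation with damping.  The k-th term vanishes at the earlier
    nodes and corrects the value at the k-th one; once damped, it is at most
    2^-k on every disc of radius less than |a_k| / 2, so that on a fixed disc
    the majorants of all but finitely many terms are bounded by 2^-k. *)
Lemma entire_interpolation (a b : nat -> Cplx R) :
  injective a -> diverges (fun k => cabs (a k)) ->
  exists2 f, entire f & forall k, f (a k) = b k.
Proof.
move=> a_inj a_oo.
have half0 : 0 < (2^-1 : R) by rewrite invr_gt0.
have Tex : forall Sk : {poly Cplx R} * nat, exists t : {poly Cplx R},
    [/\ t.[a Sk.2] = b Sk.2 - Sk.1.[a Sk.2],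
        forall j, (j < Sk.2)%N -> t.[a j] = 0
      & forall r, 0 <= r -> r < cabs (a Sk.2) / 2 -> majorant t r <= 2^-1 ^+ Sk.2].
  move=> [S k] /=; pose w : {poly Cplx R} := \prod_(j < k) ('X - (a j)%:P).
  have wE z : w.[z] = \prod_(j < k) (z - a j).
    by rewrite horner_prod; apply: eq_bigr => j _; rewrite !hornerE.
  have wk : w.[a k] != 0.
    rewrite wE; apply/prodf_neq0 => j _; rewrite subr_eq0; apply/eqP => /a_inj kj.
    by have := ltn_ord j; rewrite -kj ltnn.
  have wj j : (j < k)%N -> w.[a j] = 0.
    by move=> jk; rewrite wE (bigD1 (Ordinal jk)) //= subrr mul0r.
  have [t [tk tz tr]] := damped_poly (((b k - S.[a k]) / w.[a k]) *: w) (a k)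
    (exprn_gt0 k half0).
  exists t; split=> //; first by rewrite tk hornerZ divfK.
  by move=> j jk; apply: tz; rewrite hornerZ (wj _ jk) mulr0.
have [T TP] := choice Tex.
(* The partial sums; each term depends on the sum of the previous ones. *)
pose S := fix S k := if k is k'.+1 then S k' + T (S k', k') else 0.
pose p k := T (S k, k).
have sumS N z : \sum_(k < N) (p k).[z] = (S N).[z].
  elim: N => [|N IH]; first by rewrite big_ord0 horner0.
  by rewrite big_ord_recr /= IH hornerD.
have [r r0|f f_entire fP] := @entire_series p.
  have [K KP] := a_oo (r * 2).
  exists (\sum_(k < K) majorant (p k) r + 2) => N.
  apply: le_trans (_ : \sum_(k < K + N) majorant (p k) r <= _).
    rewrite addnC big_split_ord /= lerDl; apply: sumr_ge0 => k _.
    exact: majorant_ge0.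
  rewrite big_split_ord /= lerD2l (le_trans _ (sum_pow_half_le N)) //.
  apply: ler_sum => k _; have [_ _ /(_ r r0)] := TP (S (K + k)%N, (K + k)%N).
  rewrite /= ltr_pdivlMr // => /(_ (KP _ (leq_addr _ _)))/le_trans; apply.
  by rewrite ler_wiXn2l ?leq_addl ?invf_le1 ?ler1n // ltW.
exists f; first exact: f_entire.
move=> j.
(* From index j + 1 on, all the partial sums take the value b_j at a_j. *)
have SN d : (S (j.+1 + d)%N).[a j] = b j.
  elim: d => [|d IH].
    by rewrite addn0 /= hornerD; have [-> _ _] := TP (S j, j); rewrite addrC subrK.
  rewrite addnS [S _]/= hornerD IH.
  have [_ Tz _] := TP (S (j.+1 + d)%N, (j.+1 + d)%N).
  by rewrite [X in _ + X]Tz ?addr0 //= addSn ltnS leq_addr.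
apply: (@cvg_unique _ (@norm_hausdorff _ (Cplx R)) _ _ _ _ (fP (a j))).
apply: cvg_near_cst; apply: filterS (nbhs_infty_ge j.+1) => N jN.
by rewrite sumS -(subnKC jN) SN.
Qed.

End EntireSeries.

(** * Discrete sets and sequences tending to infinity *)

Lemma finite_nat_bounded (A : set nat) :
  finite_set A -> exists K, forall k, (K <= k)%N -> ~ A k.
Proof.
move=> /finite_seqP[s ->]; exists (\max_(i <- s) i).+1 => k Kk /= ks.
by have := @leq_bigmax_seq _ s xpredT id k ks erefl; rewrite leqNgt Kk.
Qed.

(** A set that is finite below every level of [N] is a countable union of finite
    sets; along any enumeration of it without repetition [N] tends to
    infinity. *)
Lemma proper_enumeration (R : realType) (T : pointedType) (A : set T)
    (N : T -> R) :
  infinite_set A -> (forall r, finite_set (A `&` [set x | N x <= r])) ->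
  exists2 e : nat -> T, set_bij [set: nat] A e & diverges (N \o e).
Proof.
move=> A_inf A_fin.
have A_count : countable A.
  have : A `<=` \bigcup_(m in [set: nat]) (A `&` [set x | N x <= m%:R]).
    move=> x Ax; exists (Num.bound `|N x|) => //; split => //=.
    by rewrite (le_trans (ler_norm _)) // ltW // archi_boundP.
  move/subset_card_le/sub_countable; apply; apply: bigcup_countable => // m _.
  exact: finite_set_countable.
have : ([set: nat] #= A)%card by rewrite card_eq_sym eq_card_nat.
move=> /card_set_bijP[e e_bij]; exists e => // r.
have [eA e_inj _] := e_bij.
have fin : finite_set (e @^-1` (A `&` [set x | N x <= r])).
  by apply: finite_preimage => // x y _ _; apply: e_inj; rewrite inE.
have [K KP] := finite_nat_bounded fin.
exists K => k /KP; apply: contra_notT; rewrite -leNgt => Ner.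
by split => //; exact: eA.
Qed.

Section Discrete.
Variables (R : realType) (n : nat).
Implicit Types (v : 'rV[Cplx R]_n) (D : set 'rV[Cplx R]_n).

Lemma hnorm_ge0 v : 0 <= hnorm v.
Proof. exact: sqrtr_ge0. Qed.

Lemma cabs_coord_le_hnorm v i : cabs (v ord0 i) <= hnorm v.
Proof.
rewrite /hnorm -[cabs _]ger0_norm ?cabs_ge0 // -sqrtr_sqr ler_wsqrtr //.
by rewrite (bigD1 i) //= lerDl sumr_ge0 // => j _; exact: sqr_ge0.
Qed.

(** The square is a continuous image of a product of two real segments. *)
Lemma cplx_square_compact (r : R) : compact
  [set z : Cplx R | `|complex.Re z| <= r /\ `|complex.Im z| <= r].
Proof.
pose f (xy : R * R) : Cplx R :=
  cplx_of_real xy.1 + ('i%C : Cplx R) * cplx_of_real xy.2.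
have f_cont : continuous f.
  move=> xy; apply: cvgD.
    by apply: continuous_comp; [exact: cvg_fst|exact: cplx_of_real_continuous].
  apply: cvgM; first exact: cvg_cst.
  by apply: continuous_comp; [exact: cvg_snd|exact: cplx_of_real_continuous].
have cI := @segment_compact R (- r) r.
have := continuous_compact (continuous_subspaceT f_cont) (compact_setX cI cI).
congr compact; apply/seteqP; split => [_ [[x y] [/= xr yr] <-]|z [zr zi]].
  rewrite /f /= !mul0r !mul1r !subr0 !add0r addr0.
  by move: xr yr; rewrite !in_itv /= -!ler_norml.
exists (complex.Re z, complex.Im z); last by rewrite [RHS]complexE.
by split; rewrite /= in_itv /= -ler_norml.
Qed.

(** Bolzano-Weierstrass: a sequence of distinct points of [D] in a compact
    product of squares has a cluster point, which is a limit point of [D]. *)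
Lemma discrete_bounded_finite D (r : R) : discrete_subset D ->
  finite_set (D `&` [set v | hnorm v <= r]).
Proof.
move=> D_discrete; apply: contrapT => /infiniteP/pcard_leP/injfunPex[u uB u_inj].
have := @rV_compact (Cplx R) n
  (fun=> [set z | `|complex.Re z| <= r /\ `|complex.Im z| <= r])
  (fun=> @cplx_square_compact r).
move=> /(_ (u @ \oo) _)[].
  exists 0%N => // k _ i /=; have [_ /= ur] : (D `&` [set v | hnorm v <= r]) (u k).
    exact: uB.
  have ci := le_trans (cabs_coord_le_hnorm (u k) i) ur.
  by rewrite !(le_trans _ ci) ?norm_Re_le ?norm_Im_le.
move=> p [_ p_cluster].
suff : limit_point D p by rewrite D_discrete.
move=> U pU.
have tail N : (u @ \oo) (u @` [set k | (N <= k)%N]).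
  by exists N => // k Nk; exists k.
have [_ [[k _ <-] Uk]] := p_cluster _ _ (tail 0%N) pU.
have [_ [[l kl <-] Ul]] := p_cluster _ _ (tail k.+1) pU.
(* Two distinct points of the sequence lie in U, so one of them is not p. *)
have [ukp|ukp] := eqVneq (u k) p; last first.
  by exists (u k); split => //; have [] := uB k Logic.I.
exists (u l); split => //; last by have [] := uB l Logic.I.
rewrite -ukp; apply/eqP => /u_inj lk.
by move: kl; rewrite /= lk ?inE // ltnn.
Qed.

(** Only finitely many points of the sequence have an i-th coordinate of modulus
    less than |x_i| + 1; removing those different from x leaves a neighbourhood
    of x free of other points. *)
Lemma discrete_coord_diverges (w : nat -> 'rV[Cplx R]_n) i :
  diverges (fun k => cabs (w k ord0 i)) -> discrete_subset (range w).
Proof.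
move=> w_oo; rewrite /discrete_subset -subset0 => x xlim.
have [K KP] := w_oo (cabs (x ord0 i) + 1).
pose F := w @` `I_K `\ x.
have F_closed : closed F.
  apply: compact_closed; first exact: norm_hausdorff.
  by apply: finite_compact; apply: finite_setD; exact: finite_image.
have xF : nbhs x (~` F).
  by apply: open_nbhs_nbhs; split; [exact: closed_openC|move=> [_]; exact].
have coord_lt : nbhs x [set y : 'rV[Cplx R]_n |
    cabs (y ord0 i) < cabs (x ord0 i) + 1].
  have c : (fun y : 'rV[Cplx R]_n => cabs (y ord0 i)) @ x --> cabs (x ord0 i).
    by apply: continuous_comp; [exact: coord_continuous|exact: cabs_continuous].
  by apply: (cvgr_lt _ c); rewrite ltrDl.
have [y [yx [k _ wk_y] [yF y_lt]]] := xlim _ (filterI xF coord_lt).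
apply: yF; split; last exact/eqP.
exists k => //=; rewrite ltnNge; apply/negP => /KP.
by rewrite wk_y ltNge (ltW y_lt).
Qed.

End Discrete.

(** * Shears and tame sequences *)

(** A translation by a vector depending on the i-th coordinate.  When [g i = 0],
    that coordinate is preserved, so that the translation can be undone. *)
Definition shear (R : realType) (n : nat) (i : 'I_n)
    (g : 'I_n -> Cplx R -> Cplx R) (x : 'rV[Cplx R]_n) : 'rV[Cplx R]_n :=
  x + \sum_j g j (x ord0 i) *: delta_mx ord0 j.

Section Automorphisms.
Variables (R : realType) (n : nat).
Implicit Types (x : 'rV[Cplx R]_n) (f g : 'rV[Cplx R]_n -> 'rV[Cplx R]_n).

Lemma shearE (i : 'I_n) (g : 'I_n -> Cplx R -> Cplx R) x j :
  shear i g x ord0 j = x ord0 j + g j (x ord0 i).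
Proof.
rewrite mxE summxE (bigD1 j) //= !mxE !eqxx mulr1 big1 ?addr0 // => l lj.
by rewrite !mxE eqxx (eq_sym j) (negbTE lj) mulr0.
Qed.

Lemma shear_holomorphic (i : 'I_n) (g : 'I_n -> Cplx R -> Cplx R) :
  (forall j, entire (g j)) -> holomorphic (shear i g).
Proof.
move=> g_entire x.
have -> : shear i g = id + \sum_j (fun y : 'rV_n => g j (y ord0 i) *: delta_mx ord0 j).
  by apply/funext => y; rewrite /shear /= fct_sumE.
apply: differentiableD; first exact: ex_diff.
apply: differentiable_sum => j; apply: differentiableZl.
apply: (@differentiable_comp _ _ _ _ (fun y : 'rV_n => y ord0 i)).
  exact: differentiable_coord.
exact: g_entire.
Qed.

Lemma entireN (h : Cplx R -> Cplx R) : entire h -> entire (fun z => - h z).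
Proof. by move=> h_entire z; apply: differentiableN; exact: h_entire. Qed.

Lemma entire_cst0 : entire (fun=> 0 : Cplx R).
Proof. by move=> z; exact: ex_diff. Qed.

Lemma entire_id : entire (fun z : Cplx R => z).
Proof. by move=> z; exact: ex_diff. Qed.

Lemma shear_automorphism (i : 'I_n) (g : 'I_n -> Cplx R -> Cplx R) :
  (forall j, entire (g j)) -> g i = (fun=> 0) ->
  holomorphic_automorphism (shear i g).
Proof.
move=> g_entire gi; split; first exact: shear_holomorphic.
exists (shear i (fun j z => - g j z)); split.
- by apply: shear_holomorphic => j; apply: entireN; exact: g_entire.
- by move=> x; apply/rowP => j; rewrite !shearE gi addr0 addrK.
- by move=> x; apply/rowP => j; rewrite !shearE gi oppr0 addr0 subrK.
Qed.

Lemma automorphism_comp f g :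
  holomorphic_automorphism f -> holomorphic_automorphism g ->
  holomorphic_automorphism (f \o g).
Proof.
move=> [f_hol [f' [f'_hol fK f'K]]] [g_hol [g' [g'_hol gK g'K]]]; split.
  by move=> x; apply: differentiable_comp; [exact: g_hol|exact: f_hol].
exists (g' \o f'); split; [|exact: can_comp|exact: can_comp].
by move=> x; apply: differentiable_comp; [exact: f'_hol|exact: g'_hol].
Qed.

End Automorphisms.

HB.instance Definition _ := isPointed.Build int 0.

Lemma int_enumeration (R : realType) : exists2 e : nat -> int,
  bijective e & diverges (fun k => `|(e k)%:~R : R|).
Proof.
have [||e e_bij e_oo] := @proper_enumeration R int [set: int] (fun z => `|z%:~R|).
- move=> fin; apply: infinite_nat.
  apply: (@sub_finite_set _ _ (Posz @^-1` setT)) => //.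
  by apply: finite_preimage => // x y _ _ [].
- move=> r; have fin := finite_II (Num.bound r).+1.
  apply: (@sub_finite_set _ _ (Posz @` `I_(Num.bound r).+1
    `|` (fun m => - m%:Z) @` `I_(Num.bound r).+1)).
    move=> z [_ /=]; rewrite -intr_norm => zr.
    have zb : (absz z < (Num.bound r).+1)%N.
      rewrite ltnS -(ler_nat R) natr_absz (le_trans zr) //.
      have [r0|r0] := leP 0 r; first by rewrite ltW // archi_boundP.
      by rewrite (le_trans (ltW r0)).
    by case: (intP z) zb => [|m|m] zb; [left; exists 0%N|left; exists m.+1|right; exists m.+1].
  by rewrite finite_setU; split; exact: finite_image.
- by exists e => //; rewrite -setTT_bijective.
Qed.

(** Let a_k be the first coordinates and t_k an enumeration of the integers.  A
    shear along the first coordinate moves the points to (a_k, t_k, 0, ..., 0),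
    one along the second coordinate to (t_k, t_k, 0, ..., 0), and
    (x, y, ...) |-> (x, y - x, ...) to (t_k, 0, ..., 0).  The detour through the
    second coordinate is needed because a shear cannot change the coordinate
    along which it is taken. *)
Lemma tame_of_injective_coord (R : realType) (n : nat)
    (w : nat -> 'rV[Cplx R]_n.+2) :
  injective (fun k => w k ord0 ord0) ->
  diverges (fun k => cabs (w k ord0 ord0)) -> tame (range w).
Proof.
move=> w_inj w_oo; have [e e_bij e_oo] := int_enumeration R.
pose a k := w k ord0 ord0; pose t k : Cplx R := (e k)%:~R.
pose i0 : 'I_n.+2 := ord0; pose i1 : 'I_n.+2 := lift ord0 ord0.
have tE k : t k = cplx_of_real (e k)%:~R by rewrite /t -(rmorph_int (real_complex R)).
have t_inj : injective t by move=> k l /intr_inj; exact: (bij_inj e_bij).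
have t_oo : diverges (fun k => cabs (t k)).
  move=> r; have [K KP] := e_oo r; exists K => k /KP.
  by rewrite tE cabs_real.
have Gex j : exists G : Cplx R -> Cplx R, entire G /\
    forall k, G (a k) = (if j == i1 then t k else 0) - w k ord0 j.
  have [G G_entire GP] := entire_interpolation
    (fun k => (if j == i1 then t k else 0) - w k ord0 j) w_inj w_oo.
  by exists G; split; [exact: G_entire|exact: GP].
have [G GP] := choice Gex.
have [H H_entire HP] := entire_interpolation (fun k => t k - a k) t_inj t_oo.
pose f1 := shear i0 (fun j => if j == i0 then fun=> 0 else G j).
pose f2 := shear i1 (fun j => if j == i0 then H else fun=> 0).
pose f3 := shear i0 (fun j => if j == i1 then fun z : Cplx R => - z else fun=> 0).
have f_aut : holomorphic_automorphism (f3 \o (f2 \o f1)).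
  apply: automorphism_comp; [|apply: automorphism_comp];
    apply: shear_automorphism => //.
  - by move=> j; case: eqP => _; [apply: entireN; exact: entire_id|exact: entire_cst0].
  - by move=> j; case: eqP => _; [exact: H_entire|exact: entire_cst0].
  - by move=> j; case: eqP => _; [exact: entire_cst0|have [] := GP j].
have fE k : f3 (f2 (f1 (w k))) = \row_(i < n.+2) (if val i == 0%N then t k else 0).
  have f1E j : f1 (w k) ord0 j =
      if j == i0 then a k else if j == i1 then t k else 0.
    rewrite shearE; case: eqP => [->|_]; first by rewrite addr0.
    by have [_ ->] := GP j; rewrite addrC subrK.
  have f2E j : f2 (f1 (w k)) ord0 j =
      if (j == i0) || (j == i1) then t k else 0.
    rewrite shearE !f1E eqxx; case: (j == i0); last by rewrite addr0.
    by rewrite /= HP addrC subrK.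
  apply/rowP => j; rewrite shearE !f2E eqxx mxE -[val j == 0%N]/(j == i0).
  have [->|_] := eqVneq j i0; first by rewrite addr0.
  by rewrite /=; case: (j == i1); rewrite ?subrr ?addr0.
exists (f3 \o (f2 \o f1)); split; first exact: f_aut.
apply/seteqP; split => [_ [_ [k _ <-] <-]|_ [z _ <-]].
  by exists (e k) => //; rewrite [RHS]fE.
have [e' _ e'K] := e_bij.
exists (w (e' z)); first by exists (e' z).
by rewrite [LHS]fE /t e'K.
Qed.

(** * Displacing a discrete set *)

(** Sequential choice: the new element has to avoid only the finitely many
    elements already chosen.  The hypothesis remembers that these come from
    earlier sets, for the benefit of a singleton [A k] disjoint from the
    others. *)
Lemma injective_selection (T : pointedType) (A : nat -> set T) :
  (forall k (F : seq T), (forall x, x \in F -> exists2 j, (j < k)%N & A j x) ->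
     exists2 x, A k x & x \notin F) ->
  exists2 a : nat -> T, injective a & forall k, A k (a k).
Proof.
move=> avoid.
have cex (kF : nat * seq T) : exists x : T,
    (forall y, y \in kF.2 -> exists2 j, (j < kF.1)%N & A j y) ->
    A kF.1 x /\ x \notin kF.2.
  have [/avoid[x Ax xF]|not_pre] := pselect (forall y, y \in kF.2 ->
    exists2 j, (j < kF.1)%N & A j y).
    by exists x.
  by exists point.
have [c cP] := choice cex.
pose L := fix L k := if k is k'.+1 then c (k', L k') :: L k' else [::].
have LP k : forall y, y \in L k -> exists2 j, (j < k)%N & A j y.
  elim: k => // k IH y; rewrite inE => /predU1P[->|/IH[j jk Ay]].
    by exists k => //; have [] := cP (k, L k) IH.
  by exists j => //; exact: ltnW.
have L_mem j d : c (j, L j) \in L (j + d.+1)%N.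
  elim: d => [|d IH]; first by rewrite addn1 mem_head.
  by rewrite addnS inE IH orbT.
have c_neq j k : (j < k)%N -> c (j, L j) <> c (k, L k).
  move=> jk jk_eq; have [_ /negP] := cP (k, L k) (LP k); apply.
  by rewrite -jk_eq -(subnKC jk) addSnnS /=; exact: L_mem.
exists (fun k => c (k, L k)) => [j k jk_eq|k]; last by have [] := cP (k, L k) (LP k).
by case: (ltngtP j k) => // [/c_neq|/c_neq/nesym].
Qed.

Section Displacement.
Variable R : realType.
Implicit Types (c z : Cplx R) (h : R).

(** The new first coordinate z allowed for a point of norm h with first
    coordinate c: the first and the last bound make it tend to infinity with h,
    the last two are the metric estimates on the displacement. *)
Definition admissible h c z : Prop :=
  [/\ h / 4 <= cabs (z - c), cabs (z - c) <= h / 2 & cabs (z - c) <= cabs z].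

(** Infinitely many real displacements, directed away from the imaginary axis,
    are admissible. *)
Lemma admissible_avoid h c (F : seq (Cplx R)) : 0 < h ->
  exists2 z, admissible h c z & z \notin F.
Proof.
move=> h0; pose s : R := if 0 <= complex.Re c then 1 else -1.
pose t (m : nat) : R := h / 4 + h / 4 * m.+1%:R^-1.
pose z m : Cplx R := c + cplx_of_real (s * t m).
have t_ge m : h / 4 <= t m by rewrite lerDl mulr_ge0 ?divr_ge0 // ltW.
have t_ge0 m : 0 <= t m by rewrite (le_trans _ (t_ge m)) // divr_ge0 // ltW.
have t_le m : t m <= h / 2.
  rewrite (_ : h / 2 = h / 4 + h / 4); last by field.
  by rewrite lerD2l ger_pMr ?divr_gt0 // invf_le1 ?ler1n ?ltr0n.
have zc m : cabs (z m - c) = t m.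
  rewrite /z addrC addKr cabs_real normrM (ger0_norm (t_ge0 m)).
  by rewrite /s; case: ifP => _; rewrite ?normrN normr1 mul1r.
have z_adm m : admissible h c (z m).
  split; rewrite ?zc //; apply: le_trans (norm_Re_le _).
  have -> : complex.Re (z m) = complex.Re c + s * t m.
    by rewrite /z; case: (c).
  rewrite /s; case: (leP 0 (complex.Re c)) => c0.
    by rewrite mul1r ger0_norm ?lerDr // (addr_ge0 c0 (t_ge0 m)).
  rewrite mulN1r ltr0_norm; last first.
    by rewrite -opprB oppr_lt0 subr_gt0 (lt_le_trans c0).
  by rewrite opprD opprK lerDr oppr_ge0 ltW.
have z_inj : injective z.
  move=> i j /addrI/complexI; rewrite /s => sij.
  have : t i = t j by move: sij; case: ifP => _; rewrite ?mulN1r ?mul1r // => /oppr_inj.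
  move=> /addrI/(mulfI _) /invr_inj ij.
  have /eqP : (i.+1%:R : R) = j.+1%:R by apply: ij; rewrite gt_eqF // divr_gt0.
  by rewrite eqr_nat => /eqP[].
have [[m zF]|all_in] := pselect (exists m, z m \notin F).
  by exists (z m).

exfalso; apply: infinite_nat.
have -> : [set: nat] = z @^-1` [set` F].
  apply/seteqP; split => // m _ /=; apply: contrapT => /negP zF.
  by apply: all_in; exists m.
by apply: finite_preimage => // x y _ _; exact: z_inj.
Qed.

Lemma hnorm_eq0 n (v : 'rV[Cplx R]_n) : hnorm v = 0 -> v = 0.
Proof.
move=> v0; apply/rowP => i; rewrite mxE; apply/eqP; rewrite -cabs_eq0.
by rewrite eq_le cabs_ge0 andbT -v0 cabs_coord_le_hnorm.
Qed.

Lemma hnorm_scale_delta n (d : Cplx R) (i : 'I_n) :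
  hnorm (d *: delta_mx ord0 i) = cabs d.
Proof.
rewrite /hnorm (bigD1 i) //= !mxE !eqxx mulr1 big1 => [|j ji].
  by rewrite addr0 sqrtr_sqr ger0_norm // cabs_ge0.
by rewrite !mxE eqxx (negbTE ji) mulr0 Normc.normc0 expr0n.
Qed.

End Displacement.

Theorem mainTheorem5 (R : realType) (n : nat) (n_gt1 : (1 < n)%N)
    (D : set 'rV[Cplx R]_n)
    (D_infinite : infinite_set D) (D_discrete : discrete_subset D)
    (D_nontame : ~ tame D) :
  exists (D' : set 'rV[Cplx R]_n) (alpha : 'rV[Cplx R]_n -> 'rV[Cplx R]_n),
    [/\ discrete_subset D', tame D', set_bij D D' alpha,
        forall v, D v ->
          hnorm (alpha v - v) <= (Num.sqrt 2)^-1 * hnorm v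
      & forall w, D' w ->
          hnorm (w - pinv D alpha w) <= hnorm w].
Proof.
case: n n_gt1 D D_infinite D_discrete D_nontame => [//|[//|n]] _ D D_inf D_disc _.
have [e [eD e_inj e_surj] e_oo] :=
  proper_enumeration D_inf (fun r => discrete_bounded_finite r D_disc).
have {}e_inj : injective e by move=> j k; apply: e_inj; rewrite inE.
pose c k := e k ord0 ord0.
have [k F F_prev|a a_inj a_adm] :=
    @injective_selection (Cplx R) (fun k => admissible (hnorm (e k)) (c k)).
  have [ek0|ek0] := eqVneq (hnorm (e k)) 0; last first.
    by apply: admissible_avoid; rewrite lt_def ek0 hnorm_ge0.
  (* The origin stays in place; no other point is sent to coordinate 0. *)
  exists 0.
    rewrite /admissible ek0 /c (hnorm_eq0 ek0) mxE subrr cabs0 !mul0r.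
    by split.
  apply/negP => /F_prev[j jk [ej_le _ c_le]].
  have cj_le : cabs (0 - c j) <= 0 by move: c_le; rewrite cabs0.
  have ej0 : hnorm (e j) = 0.
    by apply/eqP; rewrite eq_le hnorm_ge0 andbT; move: (le_trans ej_le cj_le); lra.
  have jk_eq : j = k by apply: e_inj; rewrite (hnorm_eq0 ej0) (hnorm_eq0 ek0).
  by rewrite jk_eq ltnn in jk.
pose w k := e k + (a k - c k) *: delta_mx ord0 ord0.
pose alpha := w \o 'pinv_(fun=> 0%N) [set: nat] e.
have alphaE k : alpha (e k) = w k.
  rewrite /alpha /= pinvKV ?inE // => x y _ _.
  exact: e_inj.
have w_coord k : w k ord0 ord0 = a k.
  by rewrite !mxE !eqxx mulr1 addrC subrK.
have w_sub k : hnorm (w k - e k) = cabs (a k - c k).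
  by rewrite /w addrC addKr hnorm_scale_delta.
have a_oo : diverges (fun k => cabs (w k ord0 ord0)).
  move=> r; have [K KP] := e_oo (r * 4); exists K => k /KP /= rk.
  rewrite w_coord; have [lo _ hi] := a_adm k; apply: lt_le_trans hi.
  by apply: lt_le_trans lo; rewrite ltr_pdivlMr.
have w_inj : injective (fun k => w k ord0 ord0).
  by move=> j k; rewrite !w_coord; exact: a_inj.
have alpha_inj : {in D &, injective alpha}.
  move=> _ _ /set_mem/e_surj[j _ <-] /set_mem/e_surj[k _ <-].
  by rewrite !alphaE => jk; congr e; apply: w_inj; rewrite jk.
exists (range w), alpha; split.
- exact: discrete_coord_diverges a_oo.
- exact: tame_of_injective_coord.
- split; last 1 first.
  + move=> _ [k _ <-]; exists (e k); first exact: eD.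
    exact: alphaE.
  + by move=> _ /e_surj[k _ <-]; rewrite alphaE; exists k.
  + exact: alpha_inj.
- move=> _ /e_surj[k _ <-]; rewrite alphaE w_sub.
  have [_ le_half _] := a_adm k; apply: le_trans le_half _.
  rewrite mulrC ler_wpM2r ?hnorm_ge0 // lef_pV2 ?posrE ?sqrtr_gt0 //.
  rewrite -[leRHS](@ger0_norm _ 2) // -sqrtr_sqr ler_wsqrtr // expr2.
  by rewrite ler_peMr // ler1n.
- move=> _ [k _ <-]; rewrite -{1 2}alphaE pinvKV ?inE //; last exact: eD.
  rewrite alphaE w_sub; have [_ _ hi] := a_adm k; apply: le_trans hi _.
  by rewrite -w_coord cabs_coord_le_hnorm.
Qed.
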